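(* Let $b\ge1$ be an integer and $t\in[0,b]$ an integer with $2t\ge b+1$. Define $(m_n)_{n\ge0}$ by $m_n:=\varepsilon_{n+1}-(2t-b-1)\varepsilon_n+t-1$ for all $n\ge0$, where $(\varepsilon_n)_{n\ge0}$ is the Thue–Morse sequence. Then the number $\lambda\in(1,b+1)$ defined by $1=\sum_{n\ge0}m_n\lambda^{-n-1}$ is transcendental.
   Context: The Thue–Morse sequence $(\varepsilon_n)_{n\ge0}$ is defined by $\varepsilon_0=0$ and, for all $k\ge0$, $\varepsilon_{2k}=\varepsilon_k$ and $\varepsilon_{2k+1}=1-\varepsilon_k$. The sequence $(m_n)$ begins $t,\ b-t+1,\ b-t,\ t,\ b-t,\ t-1,\ldots$. *)

(* Defs.v *)
From HB Require Import structures.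
From mathcomp Require Import all_boot all_order all_algebra.
From mathcomp Require Import all_classical all_reals all_analysis.
Set Implicit Arguments.
Unset Strict Implicit.
Unset Printing Implicit Defensive.
Import Order.TTheory GRing.Theory Num.Theory.
Import numFieldNormedType.Exports.
Local Open Scope classical_set_scope.
Local Open Scope ring_scope.

(* [k] bounds the number of binary digits read; [k = n] always suffices. *)
Fixpoint thue_morse_rec (k n : nat) : int :=
  if k is k'.+1 then
    let e := thue_morse_rec k' n./2 in if odd n then 1 - e else e
  else 0.

Definition thue_morse (n : nat) : int := thue_morse_rec n n.

Lemma thue_morse_rec_stable (k n : nat) :
  (n <= k)%N -> thue_morse_rec k n = thue_morse n.
Proof.
rewrite /thue_morse.
have rec0 j : thue_morse_rec j 0 = 0 by elim: j => //= j ->.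
suff H j i m : (m <= j)%N -> (m <= i)%N ->
  thue_morse_rec j m = thue_morse_rec i m by move=> h; exact: H.
elim: j i m => [|j IH] [|i] [|m] hj hi //; rewrite ?rec0 //.
have hm : (m.+1./2 <= m)%N by rewrite leq_uphalf_double -addnn leq_addr.
by rewrite [LHS]/= [RHS]/= (IH i) // (leq_trans hm).
Qed.

Lemma thue_morse0 : thue_morse 0 = 0.
Proof. by []. Qed.

Lemma thue_morse_even (k : nat) : thue_morse k.*2 = thue_morse k.
Proof.
rewrite -(@thue_morse_rec_stable k.*2.+1) // [LHS]/= odd_double doubleK.
by rewrite thue_morse_rec_stable // -addnn leq_addr.
Qed.

Lemma thue_morse_odd (k : nat) : thue_morse k.*2.+1 = 1 - thue_morse k.
Proof.
rewrite [LHS]/thue_morse [LHS]/= odd_double /= uphalf_double.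
by rewrite thue_morse_rec_stable // -addnn leq_addr.
Qed.

Definition m_seq (b t : int) (n : nat) : int :=
  thue_morse n.+1 - (2 * t - b - 1) * thue_morse n + t - 1.

(* [series u] is the sequence of partial sums of [u]. *)
Definition defines_lambda (R : realType) (b t : int) (lam : R) : Prop :=
  [/\ 1 < lam, lam < (b + 1)%:~R &
      series (fun n => (m_seq b t n)%:~R * lam ^- n.+1) @ \oo --> (1 : R)].

Definition transcendental (R : realType) (x : R) : Prop :=
  ~ algebraicOver (ratr : rat -> R) x.

(* Main.v *)
Require Import Defs.
From HB Require Import structures.
From mathcomp Require Import all_boot all_order all_fingroup all_algebra.
From mathcomp Require Import all_classical all_reals all_analysis.
From mathcomp Require Import ring lra zify.
Set Implicit Arguments.
Unset Strict Implicit.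
Unset Printing Implicit Defensive.
Import Order.TTheory GRing.Theory Num.Theory.
Import numFieldNormedType.Exports.
Local Open Scope classical_set_scope.
Local Open Scope ring_scope.

(** The number lambda is the inverse of the point where a power series with
    bounded nonnegative coefficients takes the value 1.  For transcendence put
    al = 1 / lambda and T(y) = sum (-1)^(eps_n) y^n, so that
    T(y) = (1 - y) T(y^2).  The equation defining lambda reads
    T(al) (1 - al) (1 - (2t - b - 1) al) = (b + 1) al - 1, hence T(al) lies in
    Q(al) if al is algebraic.  This is refuted by Mahler's method.  Linear
    algebra gives a nonzero integer form E(y) = sum_(i,j < n) h_ij y^i T(y)^j
    vanishing to order n(n - 1) at 0.  At y = al^(2^k) the form E is not
    eventually zero in k, since T is transcendental over the rational functions;
    its size is at most C al^(2^k n(n-1)).  On the other hand, after clearing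
    the denominators prod_(i < k) (1 - al^(2^i)), it is an element of Q(al) of
    degree O(n 2^k) in al, and a Liouville-type inequality bounds a nonzero such
    element below by C^(-n 2^k).  For n large this is a contradiction as
    k tends to infinity. *)

(** * Integer matrices representing elements of a number field *)

Section EntrySum.
Context {K : realDomainType}.

(** This norm is submultiplicative with constant 1, so the bounds below multiply along products of
    matrices. *)
Definition entry_sum m n (M : 'M[K]_(m, n)) : K := \sum_i \sum_j `|M i j|.

Lemma entry_sum_ge0 m n (M : 'M[K]_(m, n)) : 0 <= entry_sum M.
Proof. by apply: sumr_ge0 => i _; apply: sumr_ge0. Qed.

Lemma le_entry_sum m n (M : 'M[K]_(m, n)) i j : `|M i j| <= entry_sum M.
Proof.
rewrite /entry_sum (bigD1 i) //= (bigD1 j) //= -addrA lerDl addr_ge0 //.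
  by apply: sumr_ge0.
by apply: sumr_ge0 => k _; apply: sumr_ge0.
Qed.

Lemma entry_sumD m n (M N : 'M[K]_(m, n)) :
  entry_sum (M + N) <= entry_sum M + entry_sum N.
Proof.
rewrite /entry_sum -big_split /=; apply: ler_sum => i _.
rewrite -big_split /=; apply: ler_sum => j _.
by rewrite mxE ler_normD.
Qed.

Lemma entry_sumZ m n a (M : 'M[K]_(m, n)) :
  entry_sum (a *: M) = `|a| * entry_sum M.
Proof.
rewrite /entry_sum mulr_sumr; apply: eq_bigr => i _.
by rewrite mulr_sumr; apply: eq_bigr => j _; rewrite mxE normrM.
Qed.

Lemma entry_sum_mul m n p (M : 'M[K]_(m, n)) (N : 'M[K]_(n, p)) :
  entry_sum (M *m N) <= entry_sum M * entry_sum N.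
Proof.
rewrite [X in _ <= X * _]/entry_sum mulr_suml; apply: ler_sum => i _.
apply: (@le_trans _ _ (\sum_k \sum_j `|M i j| * `|N j k|)).
  apply: ler_sum => k _; rewrite mxE (le_trans (ler_norm_sum _ _ _)) //.
  by apply: ler_sum => j _; rewrite normrM.
rewrite exchange_big mulr_suml; apply: ler_sum => j _.
rewrite -mulr_sumr ler_wpM2l // /entry_sum [leRHS](bigD1 j) //= lerDl.
by apply: sumr_ge0 => k _; apply: sumr_ge0.
Qed.

Lemma entry_sum1 n : entry_sum (1%:M : 'M[K]_n) = n%:R.
Proof.
rewrite /entry_sum -[n in RHS]card_ord -sum1_card natr_sum.
apply: eq_bigr => i _; rewrite (bigD1 i) //= big1 => [|j neq_ji].
  by rewrite mxE eqxx normr1 addr0.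
by rewrite mxE eq_sym (negbTE neq_ji) normr0.
Qed.

Lemma normr_det_le n (M : 'M[K]_n) c :
  (forall i j, `|M i j| <= c) -> `|\det M| <= n`!%:R * c ^+ n.
Proof.
move=> Mc; rewrite /determinant (le_trans (ler_norm_sum _ _ _)) //.
rewrite -card_Sn -sumr_const mulr_suml; apply: ler_sum => s _.
rewrite normrM normrX normrN1 expr1n !mul1r normr_prod.
rewrite -[n in X in _ <= X]card_ord -prodr_const.
by apply: ler_prod => i _; rewrite normr_ge0 Mc.
Qed.

End EntrySum.

Section MatrixRep.
Variables (R : realDomainType) (d : nat) (v : 'cV[R]_d.+1) (a B : int).
Hypotheses (a_gt0 : 0 < a) (le_aB : a <= B).
Hypothesis v_free :
  forall w : 'rV[int]_d.+1, map_mx intr w *m v = 0 -> w = 0.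
Hypothesis v0 : v ord0 ord0 = 1.
Hypothesis v_le1 : forall i, `|v i ord0| <= 1.

(* An integer matrix representing multiplication by a ^ D z; B bounds the
   growth of its entries per unit of D. *)
Definition matrix_rep (z : R) (D : nat) (c : int) : Prop :=
  exists2 M : 'M[int]_d.+1,
    map_mx intr M *m v = (a%:~R ^+ D * z) *: v & entry_sum M <= c * B ^+ D.

Let B_gt0 : 0 < B. Proof. exact: lt_le_trans le_aB. Qed.

Lemma matrix_rep_ge0 z D c : matrix_rep z D c -> 0 <= c.
Proof.
case=> M _ Mc; have := le_trans (entry_sum_ge0 M) Mc.
by rewrite pmulr_lge0 // exprn_gt0.
Qed.

(** Rescaling the matrix by [a ^+ (D' - D)] raises the exponent, and [a <= B] preserves the entry
    bound. This brings summands to a common exponent. *)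
Lemma matrix_rep_le z D c D' c' : matrix_rep z D c ->
  (D <= D')%N -> c <= c' -> matrix_rep z D' c'.
Proof.
move=> rz leD lec; have c_ge0 := matrix_rep_ge0 rz.
case: rz => M Mv Mc; exists (a ^+ (D' - D) *: M).
  rewrite map_mxZ -scalemxAl Mv scalerA rmorphXn /= mulrA -exprD subnK //.
rewrite entry_sumZ ger0_norm ?exprn_ge0 ?(ltW a_gt0) //.
rewrite -[in leRHS](subnK leD) exprD mulrCA.
apply: ler_pM; rewrite ?exprn_ge0 ?entry_sum_ge0 ?(ltW a_gt0) //.
  by rewrite lerXn2r // nnegrE ltW.
by rewrite (le_trans Mc) // ler_wpM2r // exprn_ge0 // ltW.
Qed.

Lemma matrix_rep_int (k : int) : matrix_rep k%:~R 0 (`|k| * d.+1%:R).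
Proof.
exists (k *: 1%:M); first by rewrite map_mxZ map_mx1 -scalemxAl mul1mx mul1r.
by rewrite entry_sumZ entry_sum1 mulr1.
Qed.

Lemma matrix_repM z D c z' D' c' : matrix_rep z D c -> matrix_rep z' D' c' ->
  matrix_rep (z * z') (D + D') (c * c').
Proof.
move=> [M Mv Mc] [N Nv Nc]; exists (M *m N).
  rewrite map_mxM -mulmxA Nv -scalemxAr Mv scalerA exprD.
  by congr (_ *: _); rewrite mulrACA; congr (_ * _); apply: mulrC.
rewrite (le_trans (entry_sum_mul _ _)) // exprD mulrACA.
by apply: ler_pM; rewrite ?entry_sum_ge0.
Qed.

Lemma matrix_repD z z' D c c' : matrix_rep z D c -> matrix_rep z' D c' ->
  matrix_rep (z + z') D (c + c').
Proof.
move=> [M Mv Mc] [N Nv Nc]; exists (M + N).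
  by rewrite map_mxD mulmxDl Mv Nv -scalerDl mulrDr.
by rewrite (le_trans (entry_sumD _ _)) // mulrDl lerD.
Qed.

Lemma matrix_rep_sum (I : Type) (s : seq I) (F : I -> R) D (c : I -> int) :
  (forall i, matrix_rep (F i) D (c i)) ->
  matrix_rep (\sum_(i <- s) F i) D (\sum_(i <- s) c i).
Proof.
move=> H; elim: s => [|i s IHs]; last by rewrite !big_cons; apply: matrix_repD.
rewrite !big_nil; apply: (@matrix_rep_le _ 0 0) => //.
by have := matrix_rep_int 0; rewrite normr0 mul0r.
Qed.

(** The factor [d.+1%:R] is the entry sum of the identity matrix, which represents the zeroth
    power. *)
Lemma matrix_repX z D c j : matrix_rep z D c ->
  matrix_rep (z ^+ j) (j * D) (d.+1%:R * c ^+ j).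
Proof.
move=> rz; elim: j => [|j IHj].
  by have := matrix_rep_int 1; rewrite normr1 mul1r expr0 mulr1.
by rewrite !exprS mulSn mulrCA; apply: matrix_repM.
Qed.

(** A Liouville inequality: the determinant of [M] is a nonzero integer, and the adjugate identity
    applied to [v] exhibits it as [a ^+ D * z] times a bounded combination of cofactors. *)
Lemma matrix_rep_lower_bound z D c : matrix_rep z D c -> z != 0 ->
  1 <= `|z| * (a ^+ D * (d.+1%:R * (d`!%:R * (c * B ^+ D) ^+ d)))%:~R.
Proof.
move=> [M Mv Mc] z_neq0; have a_neq0 : (a%:~R ^+ D : R) != 0.
  by rewrite expf_neq0 // intr_eq0 gt_eqF.
(* A row that kills [M] from the left also kills [a ^+ D * z] times [v], hence [v], against
   [v_free]. *)
have detM_neq0 : \det M != 0.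
  apply/det0P => -[w w_neq0 wM]; move/eqP: w_neq0; apply; apply: v_free.
  have : map_mx intr w *m (map_mx intr M *m v) = 0 :> 'M[R]_(1, 1).
    by rewrite mulmxA -map_mxM wM map_mx0 mul0mx.
  rewrite Mv -scalemxAr => /eqP; rewrite scalemx_eq0 mulf_eq0.
  by rewrite (negbTE a_neq0) (negbTE z_neq0) => /eqP.
(* Coordinate 0 of the adjugate identity, where [v] is 1. *)
have adjv : (\det M)%:~R = a%:~R ^+ D * z
    * \sum_j (\adj M ord0 j)%:~R * v j ord0.
  have /(congr1 (fun N => (map_mx intr N *m v) ord0 ord0)) := mul_adj_mx M.
  rewrite map_mxM -mulmxA Mv map_scalar_mx mul_scalar_mx -scalemxAr.
  rewrite !mxE v0 mulr1 => <-; congr (_ * _).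
  by apply: eq_bigr => j _; rewrite mxE.
have adj_le j : `|\adj M ord0 j| <= d`!%:R * (c * B ^+ D) ^+ d.
  rewrite mxE normrM normrX normrN1 expr1n mul1r.
  apply: normr_det_le => i k; rewrite !mxE.
  exact: le_trans (le_entry_sum _ _ _) Mc.
have : 1 <= `|(\det M)%:~R : R|.
  by rewrite -intr_norm ler1z -gtz0_ge1 normr_gt0.
move/le_trans; apply; rewrite adjv !normrM normrX.
rewrite [`|a%:~R|]ger0_norm ?ler0z ?(ltW a_gt0) // [_ * `|z|]mulrC -!mulrA.
rewrite ler_wpM2l // intrM rmorphXn /=.
rewrite ler_wpM2l ?exprn_ge0 ?ler0z ?(ltW a_gt0) //.
rewrite (le_trans (ler_norm_sum _ _ _)) // mulr_natl rmorphMn /=.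
rewrite -[d.+1 in leRHS]card_ord -sumr_const.
apply: ler_sum => j _; rewrite normrM -[leRHS]mulr1.
by apply: ler_pM => //; rewrite -intr_norm ler_int.
Qed.

End MatrixRep.

Lemma algebraic_int_root (R : numFieldType) (x : R) :
  algebraicOver (ratr : rat -> R) x ->
  exists2 f : {poly int}, f != 0 & root (map_poly intr f) x.
Proof.
case=> p p_neq0; have [q [a a_neq0 Dp]] := rat_poly_scale p.
rewrite {}Dp in p_neq0 *; rewrite map_polyZ /= rootZ; last first.
  by rewrite fmorph_eq0 invr_eq0 intr_eq0.
rewrite -map_poly_comp (eq_map_poly (g := intr)) => [|z /=]; last exact: ratr_int.
by exists q => //; apply: contraNneq p_neq0 => ->; rewrite rmorph0 scaler0.
Qed.

Lemma int_root_minimal (R : realFieldType) (x : R) :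
  algebraicOver (ratr : rat -> R) x ->
  exists f : {poly int}, [/\ 0 < lead_coef f, root (map_poly intr f) x &
    forall g : {poly int}, (size g < size f)%N ->
      (map_poly intr g).[x] = 0 -> g = 0].
Proof.
move=> /algebraic_int_root[f0 f0_neq0 f0x].
pose S n := `[< exists2 f : {poly int}, f != 0 /\ size f = n &
                 root (map_poly intr f) x >].
have exS : exists n, S n by exists (size f0); apply/asboolP; exists f0.
case: (ex_minnP exS) => n /asboolP[f [f_neq0 sz_f] fx] minn.
exists (sgz (lead_coef f) *: f); split.
- by rewrite lead_coefZ -normrEsg normr_gt0 lead_coef_eq0.
- by rewrite map_polyZ rootZ // intr_eq0 sgz_eq0 lead_coef_eq0.
move=> g; rewrite size_scale ?sgz_eq0 ?lead_coef_eq0 // sz_f => lt_gn gx.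
apply: contraTeq lt_gn => g_neq0; rewrite -leqNgt minn //.
by apply/asboolP; exists g => //; apply/eqP.
Qed.

(** Here [v] consists of the powers of [x] below its degree: their independence is the minimality of
    the degree, and multiplication by [x] is given by a companion matrix. *)
Lemma algebraic_matrix_rep (R : realFieldType) (x : R) :
  `|x| <= 1 -> algebraicOver (ratr : rat -> R) x ->
  exists d (v : 'cV[R]_d.+1) (a B : int),
    [/\ 0 < a, a <= B,
        forall w : 'rV[int]_d.+1, map_mx intr w *m v = 0 -> w = 0,
        v ord0 ord0 = 1 & forall i, `|v i ord0| <= 1]
    /\ matrix_rep v a B x 1 1.
Proof.
move=> x_le1 /int_root_minimal[f [f_gt0 /rootP fx f_min]].
have f_neq0 : f != 0 by rewrite -lead_coef_eq0 gt_eqF.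
have [d sz_f] : exists d, size f = d.+2.
  case sz: (size f) => [|[|d]]; last by exists d.
    by move/eqP: sz; rewrite size_poly_eq0 (negbTE f_neq0).
  have /eqP/size_poly1P[c c_neq0 Df] := sz.
  by move/eqP: fx; rewrite Df map_polyC hornerC intr_eq0 (negbTE c_neq0).
pose v := \col_(i < d.+1) x ^+ i.
pose a := lead_coef f.
(* This is [a] times the companion matrix: each row but the last shifts the powers, and the last one
   rewrites [a * x ^+ d.+1] by the equation of [x]. *)
pose A : 'M[int]_d.+1 :=
  \matrix_(i, j) if i == ord_max then - f`_j else a *+ (j == i.+1 :> nat).
(* This [B] dominates both [a] and the entry sum of [A], so the constant can be 1. *)
exists d, v, a, (a + entry_sum A); split; first split => //.
- by rewrite lerDl entry_sum_ge0.
- move=> w wv; have w0 : rVpoly w = 0.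
    apply: f_min; first by rewrite sz_f ltnS size_poly.
    rewrite (@horner_coef_wide _ d.+1); last first.
      by rewrite (leq_trans (size_poly _ _)) // size_poly.
    move/matrixP/(_ ord0 ord0): wv; rewrite !mxE; apply: etrans.
    by apply: eq_bigr => i _; rewrite coef_map /= coef_rVpoly_ord !mxE.
  by rewrite -[w]rVpolyK w0 linear0.
- by rewrite mxE expr0.
- by move=> i; rewrite mxE normrX exprn_ile1.
exists A; last by rewrite mul1r expr1 lerDr ltW.
apply/matrixP => i j; rewrite !mxE expr1 ord1 {j}.
have [->|i_neq] := eqVneq i ord_max.
  move: fx; rewrite (@horner_coef_wide _ d.+2); last first.
    by rewrite -sz_f size_poly.
  rewrite big_ord_recr /= coef_map /= /a lead_coefE sz_f /= => /eqP.
  rewrite addrC addr_eq0 -mulrA -exprS => /eqP ->; rewrite -sumrN.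
  by apply: eq_bigr => j _; rewrite !mxE eqxx coef_map /= rmorphN mulNr.
have lt_i : (i.+1 < d.+1)%N.
  by rewrite ltn_neqAle ltn_ord andbT; apply: contra i_neq; rewrite -val_eqE.
rewrite (bigD1 (Ordinal lt_i)) //= !mxE (negbTE i_neq) eqxx mulr1n -mulrA -exprS.
rewrite big1 ?addr0 // => j j_neq; rewrite !mxE (negbTE i_neq).
by have /negbTE-> : j != i.+1 :> nat by []; rewrite mulr0n mul0r.
Qed.

(** * Algebraic independence and auxiliary forms *)

(* Composition with X ^ 2 preserves the order of vanishing at 1. *)
Lemma comp_sqr_eq0 (R : numFieldType) (p q : {poly R}) n :
  p * (q \Po 'X^2) * (1 - 'X) ^+ n.+1 = (p \Po 'X^2) * q -> p = 0 \/ q = 0.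
Proof.
have [->|p_neq0] := eqVneq p 0; first by left.
have [->|q_neq0] := eqVneq q 0; first by right.
have [k [p1 /implyP/(_ p_neq0) p1_1 ->]] := multiplicity_XsubC p 1.
have [l [q1 /implyP/(_ q_neq0) q1_1 ->]] := multiplicity_XsubC q 1.
have XsqrB1 : ('X - 1%:P) \Po 'X^2 = ('X - 1) * ('X + 1) :> {poly R}.
  by rewrite comp_polyB comp_polyX comp_polyC; ring.
rewrite !rmorphM !rmorphXn /= XsqrB1 !exprMn => eq_pq.
have X1_neq0 : ('X - 1 : {poly R}) != 0 by rewrite polyXsubC_eq0.
(* Both sides of [eq_pq] contain ['X - 1] to the power [k + l]. After cancellation the left side
   vanishes at 1, while the right side is a nonzero multiple of [2 ^+ k] there. *)
have : p1 * (q1 \Po 'X^2) * ('X + 1) ^+ l * (1 - 'X) ^+ n.+1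
     = (p1 \Po 'X^2) * q1 * ('X + 1) ^+ k.
  apply: (mulIf (expf_neq0 k X1_neq0)); apply: (mulIf (expf_neq0 l X1_neq0)).
  by transitivity (p1 * ('X - 1%:P) ^+ k
    * ((q1 \Po 'X^2) * (('X - 1) ^+ l * ('X + 1) ^+ l)) * (1 - 'X) ^+ n.+1);
    [ring | rewrite eq_pq; ring].
move/(congr1 (horner_eval 1)); rewrite /horner_eval.
rewrite !(hornerE, horner_comp, expr1n, exprS _ n, subrr, mul0r, mulr0).
rewrite /= mulr0 mul0r => /esym/eqP; rewrite !mulf_eq0 -!rootE (negbTE p1_1) (negbTE q1_1) /=.
by rewrite expf_eq0 -[1 + 1](natrD _ 1 1) pnatr_eq0 andbF.
Qed.

Section Independence.
Variables (R : numFieldType) (x tau : nat -> R).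
Hypothesis x_inj : injective x.
Hypothesis x_sqr : forall k, x k.+1 = x k ^+ 2.
Hypothesis x_neq1 : forall k, x k != 1.
Hypothesis tauS : forall k, tau k = (1 - x k) * tau k.+1.

Definition eventually_zero (u : nat -> R) :=
  exists k0, forall k, (k0 <= k)%N -> u k = 0.

Lemma poly_eventually_zero (p : {poly R}) :
  eventually_zero (fun k => p.[x k]) -> p = 0.
Proof.
move=> [k0 pk]; apply/eqP; apply: contraT => p_neq0.
have := max_poly_roots p_neq0 (rs := [seq x (k0 + i) | i <- iota 0 (size p)]).
rewrite size_map size_iota ltnn => -> //.
  by apply/allP => _ /mapP[i _ ->]; apply/rootP/pk/leq_addr.
by rewrite map_inj_uniq ?iota_uniq // => i j /x_inj/addnI.
Qed.

(* Replacing x by x ^ 2 in a relation and eliminating the leading term gives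
   a shorter relation, whose coefficients vanish by induction. *)
Lemma relation_trivial n (p : nat -> {poly R}) :
  ~ eventually_zero tau ->
  eventually_zero (fun k => \sum_(j < n) (p j).[x k] * tau k ^+ j) ->
  forall j, (j < n)%N -> p j = 0.
Proof.
move=> tau_nz; have tau_neq0 k : tau k != 0.
  apply/eqP => tk0; apply: tau_nz; exists k => l.
  elim: l => [|l IHl]; first by rewrite leqn0 => /eqP <-.
  rewrite leq_eqVlt => /predU1P[<- //|/IHl tl0].
  move/eqP: (tauS l); rewrite tl0 eq_sym mulf_eq0 subr_eq0 eq_sym.
  by rewrite (negbTE (x_neq1 l)) => /eqP.
elim: n p => [|n IHn] p //= [k0 relp].
(* If the top coefficient vanishes it is dropped; if the bottom one does, the relation is divided by
   [tau k]. *)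
suff pn0 : p n = 0 \/ p 0 = 0.
  case: pn0 => [pn0|p00] j.
    rewrite ltnS leq_eqVlt => /predU1P[-> //|]; apply: IHn.
    by exists k0 => k /relp; rewrite big_ord_recr /= pn0 horner0 mul0r addr0.
  case: j => [//|j]; rewrite ltnS; apply: (IHn (fun j => p j.+1)).
  exists k0 => k /relp; rewrite big_ord_recl /= p00 horner0 mul0r add0r => rel.
  apply: (mulfI (tau_neq0 k)); rewrite mulr0 -[RHS]rel mulr_sumr.
  by apply: eq_bigr => i _; rewrite mulrCA -exprS.
case: n => [|n] in IHn relp *.
  left; apply: poly_eventually_zero; exists k0 => k /relp.
  by rewrite big_ord1 expr0 mulr1.
(* Coefficients, in powers of [tau k], of the combination of the relations at [k.+1] and [k] that
   cancels the term of degree [n.+1]. That [c 0] vanishes is exactly the hypothesis of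
   [comp_sqr_eq0]. *)
pose c j := p n.+1 * (p j \Po 'X^2) * (1 - 'X) ^+ (n.+1 - j)
            - (p n.+1 \Po 'X^2) * p j.
suff /IHn/(_ 0)/(_ isT)/eqP : eventually_zero
    (fun k => \sum_(j < n.+1) (c j).[x k] * tau k ^+ j).
  by rewrite subr_eq0 => /eqP/comp_sqr_eq0.
exists k0 => k k_ge.
have cn : c n.+1 = 0 by rewrite /c subnn expr0 mulr1 mulrC subrr.
transitivity (\sum_(j < n.+2) (c j).[x k] * tau k ^+ j).
  by rewrite [RHS]big_ord_recr /= cn horner0 mul0r addr0.
pose X := (p n.+1).[x k] * (1 - x k) ^+ n.+1.
pose Y := (p n.+1).[x k.+1].
transitivity (X * (\sum_(j < n.+2) (p j).[x k.+1] * tau k.+1 ^+ j)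
              - Y * (\sum_(j < n.+2) (p j).[x k] * tau k ^+ j)); last first.
  by rewrite !relp ?mulr0 ?subr0 // leqW.
rewrite !mulr_sumr -sumrB; apply: eq_bigr => j _.
have Xsplit : (1 - x k) ^+ n.+1 = (1 - x k) ^+ (n.+1 - j) * (1 - x k) ^+ j.
  by rewrite -exprD subnK // -ltnS.
rewrite /c /X /Y !(hornerE, horner_comp) -!x_sqr (tauS k) exprMn.
by rewrite Xsplit /=; ring.
Qed.

End Independence.

(** Padding the system with zero columns makes its matrix square and singular, and the kernel vector
    has entries in [R] itself, so no denominators arise. *)
Lemma nontrivial_relation (R : idomainType) (I : finType) M (c : I -> nat -> R) :
  (M < #|I|)%N ->
  exists2 h : I -> R, exists i, h i != 0 &
    forall m, (m < M)%N -> \sum_i h i * c i m = 0.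
Proof.
move=> ltM; pose A : 'M[R]_#|I| :=
  \matrix_(i, j) if (j < M)%N then c (enum_val i) j else 0.
have /eqP/det0P[v v_neq0 vA] : \det A = 0.
  rewrite (expand_det_col A (Ordinal ltM)) big1 // => i _.
  by rewrite mxE ltnn mul0r.
exists (fun i => v ord0 (enum_rank i)).
  have /rV0Pn[i vi] : v != 0 by [].
  by exists (enum_val i); rewrite enum_valK.
move=> m ltm; move/matrixP/(_ ord0 (Ordinal (ltn_trans ltm ltM))): vA.
rewrite !mxE => vA0; rewrite -[RHS]vA0 (reindex (enum_val : 'I_#|I| -> I)) /=.
  by apply: eq_bigr => i _; rewrite enum_valK mxE /= ltm.
by exists enum_rank => i _; [apply: enum_valK | apply: enum_rankK].
Qed.

Lemma auxiliary_poly (R : idomainType) (T : {poly R}) n M : (M < n * n)%N ->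
  exists h : nat -> nat -> R, (exists i j, [/\ (i < n)%N, (j < n)%N & h i j != 0])
   /\ forall m, (m < M)%N ->
     (\sum_(j < n) (\sum_(i < n) (h i j)%:P * 'X^i) * T ^+ j)`_m = 0.
Proof.
move=> ltM.
have ltM' : (M < #|{: 'I_n * 'I_n}|)%N by rewrite card_prod !card_ord.
have [h [ij hij] hM] := nontrivial_relation
  (fun ij : 'I_n * 'I_n => fun m => ('X^(ij.1) * T ^+ ij.2)`_m) ltM'.
(* Extension of [h] by zero outside the range of the indices. *)
pose g i j := oapp (fun i => oapp (fun j => h (i, j)) 0 (insub j)) 0 (insub i).
have gE (i j : 'I_n) : g i j = h (i, j) by rewrite /g !valK.
exists g; split; first by exists ij.1, ij.2; rewrite gE -surjective_pairing.
move=> m ltm; rewrite -[RHS](hM m ltm).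
transitivity (\sum_i \sum_j h (i, j) * ('X^(i : 'I_n) * T ^+ (j : 'I_n))`_m).
  rewrite exchange_big coef_sum; apply: eq_bigr => j _.
  rewrite mulr_suml coef_sum; apply: eq_bigr => i _.
  by rewrite gE -mulrA coefCM.
by rewrite pair_big; apply: eq_bigr => -[].
Qed.

(** * Mahler's method *)

Lemma horner_small (R : realDomainType) (Q : {poly R}) M :
  (forall m, (m < M)%N -> Q`_m = 0) ->
  exists C, forall y, 0 <= y <= 1 -> `|Q.[y]| <= C * y ^+ M.
Proof.
move=> QM; exists (\sum_(i < size Q) `|Q`_i|) => y /andP[y_ge0 y_le1].
rewrite horner_coef (le_trans (ler_norm_sum _ _ _)) // mulr_suml.
apply: ler_sum => i _; rewrite normrM normrX [`|y|]ger0_norm //.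
have [lt_iM|le_Mi] := ltnP i M; first by rewrite QM // normr0 !mul0r.
by rewrite ler_wpM2l // ler_wiXn2l.
Qed.

Lemma subrX_le (R : realDomainType) (s t b : R) j : 1 <= b ->
  `|s| <= b -> `|t| <= b -> `|s ^+ j - t ^+ j| <= j%:R * b ^+ j * `|s - t|.
Proof.
move=> b_ge1 sb tb; elim: j => [|j IHj]; first by rewrite !expr0 subrr normr0 !mul0r.
have -> : s ^+ j.+1 - t ^+ j.+1 = s * (s ^+ j - t ^+ j) + (s - t) * t ^+ j.
  by rewrite !exprS; ring.
rewrite (le_trans (ler_normD _ _)) // !normrM normrX.
have b_ge0 : 0 <= b by exact: le_trans ler01 b_ge1.
have tj : `|t| ^+ j <= b ^+ j.+1.
  rewrite (@le_trans _ _ (b ^+ j)) ?lerXn2r ?nnegrE //.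
  by rewrite exprS ler_peMl // exprn_ge0.
rewrite -natr1 mulrDl mul1r mulrDl [_ * `|t| ^+ j]mulrC lerD //.
  rewrite exprS [leRHS](_ : _ = b * (j%:R * b ^+ j * `|s - t|)); last by ring.
  by apply: ler_pM.
by rewrite ler_wpM2r.
Qed.

Section UpperBound.
Variables (R : realFieldType) (al : R) (tau : nat -> R).
Hypothesis al01 : 0 < al < 1.
Let x k := al ^+ (2 ^ k).
Hypothesis tauS : forall k, tau k = (1 - x k) * tau k.+1.
Variable C : R.
Hypothesis tau_le : forall k, `|tau k - 1| <= C * x k.

Let x_gt0 k : 0 < x k. Proof. by rewrite exprn_gt0 //; case/andP: al01. Qed.
Let x_lt1 k : x k < 1.
Proof.
case/andP: al01 => al0 al1.
by rewrite exprn_ilt1 ?ltW // -lt0n expn_gt0.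
Qed.
Let xD k i : x (k + i) = x k ^+ (2 ^ i).
Proof. by rewrite /x expnD exprM. Qed.

(** This is the truncation of T(X) below degree [2 ^ K], an integer polynomial that stands in for
    the power series. *)
Definition thue_morse_prod K : {poly int} := \prod_(i < K) (1 - 'X^(2 ^ i)).

Lemma horner_thue_morse_prod K k :
  (map_poly intr (thue_morse_prod K)).[x k] = \prod_(i < K) (1 - x (k + i)).
Proof.
rewrite /thue_morse_prod rmorph_prod horner_prod; apply: eq_bigr => i _.
by rewrite rmorphB rmorph1 /= map_polyXn !hornerE xD.
Qed.

Lemma tau_prod K k : tau k = (\prod_(i < K) (1 - x (k + i))) * tau (k + K).
Proof.
elim: K => [|K IHK]; first by rewrite big_ord0 mul1r addn0.
by rewrite IHK big_ord_recr /= -mulrA addnS -tauS.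
Qed.

Lemma prod_x_ge0 K k : 0 <= \prod_(i < K) (1 - x (k + i)) <= 1.
Proof.
have x01 i : 0 <= 1 - x (k + i) <= 1.
  by rewrite subr_ge0 lerBlDr lerDl !ltW.
apply/andP; split; first by apply: prodr_ge0 => i _; case/andP: (x01 i).
by apply: prodr_ile1 => i _; apply: x01.
Qed.

(** The form is compared with its value at the truncated product: that value is small by the
    vanishing coefficients, and the error of truncation has order [2 ^ K], at least [M]. The
    constant is uniform in [k]. *)
Lemma auxiliary_small (h : nat -> nat -> int) n K M : (M <= 2 ^ K)%N ->
  (forall m, (m < M)%N ->
     (\sum_(j < n) (\sum_(i < n) (h i j)%:P * 'X^i)
                   * thue_morse_prod K ^+ j)`_m = 0) ->
  exists C', forall k,
    `|\sum_(j < n) (\sum_(i < n) (h i j)%:~R * x k ^+ i) * tau k ^+ j|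
      <= C' * x k ^+ M.
Proof.
move=> le_MK hM; have C_ge0 : 0 <= C.
  by have := le_trans (normr_ge0 _) (tau_le 0); rewrite pmulr_lge0.
pose T := thue_morse_prod K.
pose Q := \sum_(j < n) (\sum_(i < n) (h i j)%:P * 'X^i) * T ^+ j.
have [m|C1 QC1] := @horner_small R (map_poly intr Q) M.
  by move/hM => Qm; rewrite coef_map /= Qm.
(* A common bound for [tau k] and for the truncated product [t]. *)
pose b := 1 + C; have b_ge1 : 1 <= b by rewrite lerDl.
pose C2 := \sum_(j < n) (\sum_(i < n) `|(h i j)%:~R : R|) * (j%:R * b ^+ j * C).
exists (C1 + C2) => k; pose t := (map_poly intr T).[x k].
have QE : (map_poly intr Q).[x k]
    = \sum_(j < n) (\sum_(i < n) (h i j)%:~R * x k ^+ i) * t ^+ j.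
  rewrite /Q rmorph_sum horner_sum; apply: eq_bigr => j _.
  rewrite rmorphM rmorphXn hornerM horner_exp rmorph_sum horner_sum.
  congr (_ * _); apply: eq_bigr => i _.
  by rewrite rmorphM /= map_polyC map_polyXn !hornerE.
have x01 : 0 <= x k <= 1 by rewrite !ltW.
have t01 : 0 <= t <= 1 by rewrite /t horner_thue_morse_prod prod_x_ge0.
have tb : `|t| <= b by case/andP: t01 => t0 t1; rewrite ger0_norm // (le_trans t1).
have taub : `|tau k| <= b.
  rewrite -[tau k](subrK 1) (le_trans (ler_normD _ _)) // normr1 addrC lerD2l.
  by rewrite (le_trans (tau_le k)) // ler_piMr // ltW.
(* The difference is [t * (tau (k + K) - 1)], and [x (k + K)] is [x k ^+ (2 ^ K)]. *)
have tau_t : `|tau k - t| <= C * x k ^+ M.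
  rewrite (tau_prod K k) -horner_thue_morse_prod -/T -/t -[X in _ - X]mulr1.
  rewrite -mulrBr normrM ger0_norm; last by case/andP: t01.
  apply: (@le_trans _ _ (1 * (C * x (k + K)))).
    by apply: ler_pM => //; case/andP: t01.
  rewrite mul1r ler_wpM2l // xD ler_wiXn2l //; by rewrite ltW.
rewrite mulrDl (le_trans _ (lerD (QC1 _ x01) (lexx _))) //.
rewrite -lerBlDl (le_trans (lerB_dist _ _)) //.
rewrite QE -sumrB (le_trans (ler_norm_sum _ _ _)) // mulr_suml.
apply: ler_sum => j _; rewrite -mulrBr normrM -[leRHS]mulrA.
apply: ler_pM => //.
  rewrite (le_trans (ler_norm_sum _ _ _)) //; apply: ler_sum => i _.
  case/andP: x01 => x0 x1.
  by rewrite normrM ler_piMr // normrX ger0_norm // exprn_ile1.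
apply: le_trans (subrX_le j b_ge1 taub tb) _.
by rewrite -[leRHS]mulrA ler_wpM2l // mulr_ge0 // exprn_ge0 // (le_trans ler01).
Qed.

End UpperBound.

Section RepGrowth.
Variables (R : realFieldType) (d : nat) (v : 'cV[R]_d.+1) (a B : int) (al : R).
Hypotheses (a_gt0 : 0 < a) (le_aB : a <= B).
Hypothesis rep_al : matrix_rep v a B al 1 1.

Let nu : int := d.+1%:R.
(** The cost of one factor [1 - al ^+ (2 ^ i)]: [nu] for 1, and [nu * nu] for -1 times a power of
    [al]. *)
Let q : int := nu + nu * nu.
Let nu_ge1 : 1 <= nu. Proof. by rewrite /nu ler1n. Qed.
Let q_ge1 : 1 <= q. Proof. by have := nu_ge1; rewrite /q; nia. Qed.

Lemma matrix_rep_alX m : matrix_rep v a B (al ^+ m) m nu.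
Proof. by have := matrix_repX m rep_al; rewrite muln1 expr1n mulr1. Qed.

Lemma matrix_rep_poly (g : {poly int}) :
  exists D c, matrix_rep v a B (map_poly intr g).[al] D c.
Proof.
elim/poly_ind: g => [|g k [D [c rep_g]]].
  exists 0, (`|0 : int| * nu); rewrite rmorph0 horner0.
  exact: (matrix_rep_int v a B 0).
have -> : (map_poly intr (g * 'X + k%:P)).[al]
    = (map_poly intr g).[al] * al + k%:~R.
  by rewrite rmorphD rmorphM /= map_polyX map_polyC !hornerE.
exists (D + 1)%N, (c * 1 + `|k| * nu).
apply: matrix_repD; first exact: matrix_repM.
by apply: (matrix_rep_le a_gt0 le_aB (matrix_rep_int v a B k)).
Qed.

(** The exponent doubles at each step, like the degree of the product, while the constant is only
    exponential in [k], hence negligible against a power with exponent [2 ^ k]. *)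
Lemma matrix_rep_prod k :
  matrix_rep v a B (\prod_(i < k) (1 - al ^+ (2 ^ i))) (2 ^ k) (nu * q ^+ k).
Proof.
elim: k => [|k IHk].
  rewrite big_ord0 expr0 mulr1.
  apply: (matrix_rep_le a_gt0 le_aB (matrix_rep_int v a B 1)) => //.
  by rewrite normr1 mul1r.
rewrite big_ord_recr /= expnS mul2n -addnn exprSr mulrA.
apply: matrix_repM => //; apply: matrix_repD.
  apply: (matrix_rep_le a_gt0 le_aB (matrix_rep_int v a B 1)) => //.
  by rewrite normr1 mul1r.
rewrite -mulN1r -[(2 ^ k)%N]add0n; apply: matrix_repM (matrix_rep_alX _).
by have := matrix_rep_int v a B (-1); rewrite normrN1 mul1r.
Qed.

(** When [y = tau 0 * z], the sum is the auxiliary form at [al ^+ (2 ^ k)] multiplied by the n-th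
    power of [z] times the product, which clears its denominators. *)
Lemma matrix_rep_form (h : nat -> nat -> int) n (y z : R) e c0 :
  1 <= c0 -> matrix_rep v a B y e c0 -> matrix_rep v a B z e c0 ->
  exists2 c, 0 <= c & forall k, matrix_rep v a B
    (\sum_(j < n) \sum_(i < n) (h i j)%:~R * al ^+ (2 ^ k * i)
       * (y ^+ j * (z * \prod_(i < k) (1 - al ^+ (2 ^ i))) ^+ (n - j)))
    (n * ((2 + 2 * e) * 2 ^ k)) (c * (q ^+ k) ^+ n).
Proof.
move=> c0_ge1 rep_y rep_z; have c0_ge0 : 0 <= c0 by apply: le_trans c0_ge1.
have nu_ge0 : 0 <= nu by [].
have q_ge0 : 0 <= q by apply: le_trans q_ge1.
pose cc := nu * (nu * c0 ^+ n * (nu * (c0 * nu) ^+ n)).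
have cc_ge0 : 0 <= cc.
  by rewrite /cc; do ?[apply: mulr_ge0 | apply: exprn_ge0].
exists (\sum_(j < n) \sum_(i < n) `|h i j| * nu * cc).
  by do 2![apply: sumr_ge0 => ? _]; apply: mulr_ge0 => //; apply: mulr_ge0.
move=> k; rewrite mulr_suml; apply: matrix_rep_sum => // j.
rewrite mulr_suml; apply: matrix_rep_sum => // i.
have rep_zP := matrix_repM rep_z (matrix_rep_prod k).
have rep_t := matrix_repM (matrix_repM (matrix_rep_int v a B (h i j))
  (matrix_rep_alX (2 ^ k * i))) (matrix_repM (matrix_repX j rep_y)
    (matrix_repX (n - j) rep_zP)).
apply: (matrix_rep_le a_gt0 le_aB rep_t).
  (* Exponents: each of [i], [j] and [n - j] is replaced by its upper bound [n]. *)
  have [ltjn ltin] := (ltn_ord j, ltn_ord i).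
  have := expn_gt0 2 k; move: (2 ^ k)%N => w w0.
  rewrite add0n.
  have le1 : (w * i <= w * n)%N by rewrite leq_mul2l ltnW ?orbT.
  have le2 : (j * e <= n * e)%N by rewrite leq_mul2r ltnW ?orbT.
  have le3 : ((n - j) * (e + w) <= n * (e + w))%N by rewrite leq_mul2r leq_subr orbT.
  apply: leq_trans (leq_add le1 (leq_add le2 le3)) _.
  have : (n * e <= n * e * w)%N by rewrite leq_pmulr.
  by lia.
rewrite -/nu /cc -!mulrA; do 4![apply: ler_wpM2l => //].
have le_jn : c0 ^+ j <= c0 ^+ n by rewrite ler_weXn2l // ltnW.
have base_ge1 : 1 <= c0 * (nu * q ^+ k).
  by rewrite !mulr_ege1 // exprn_ege1.
apply: ler_pM => //.
- exact: exprn_ge0.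
- by apply: mulr_ge0 => //; apply/exprn_ge0/le_trans/base_ge1.
apply: ler_wpM2l => //; rewrite -exprMn -mulrA.
by rewrite ler_weXn2l // leq_subr.
Qed.

End RepGrowth.

Lemma expn_sqr_ge k : (4 <= k -> k * k <= 2 ^ k)%N.
Proof.
elim: k => // k IHk; rewrite leq_eqVlt => /predU1P[<- //|]; rewrite ltnS => k4.
by have := IHk k4; rewrite expnS; nia.
Qed.

(** By [k * k <= 2 ^ k] the quantity is at most (Q / 2^k)^k, and this is at most 2^(-k) once 2Q is
    at most 2^k. *)
Lemma superexponential_decay (R : realType) (Q A : R) : 0 <= Q ->
  exists k0, forall k, (k0 <= k)%N ->
    Q ^+ k * 2^-1 ^+ (2 ^ k) <= 1 /\ A * (Q ^+ k * 2^-1 ^+ (2 ^ k)) < 1.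
Proof.
move=> Q_ge0.
have [N1 QN1] : exists N, 2 * Q < N%:R.
  by exists (Num.bound (2 * Q)); rewrite archi_boundP // mulr_ge0.
have [N2 AN2] : exists N, `|A| < N%:R.
  by exists (Num.bound `|A|); rewrite archi_boundP.
exists (N1 + N2 + 4)%N => k le_Nk.
have k_lt : k%:R < 2 ^+ k :> R by rewrite -natrX ltr_nat ltn_expl.
have Qk : 2 * Q <= 2 ^+ k.
  rewrite (le_trans (ltW QN1)) // (le_trans _ (ltW k_lt)) // ler_nat.
  by move: le_Nk; lia.
have Ak : A < 2 ^+ k.
  rewrite (le_lt_trans (ler_norm _)) // (lt_trans AN2) //.
  by rewrite (le_lt_trans _ k_lt) // ler_nat; move: le_Nk; lia.
have u_le : Q ^+ k * 2^-1 ^+ (2 ^ k) <= 2^-1 ^+ k.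
  apply: (@le_trans _ _ (Q ^+ k * 2^-1 ^+ (k * k))).
    rewrite ler_wpM2l ?exprn_ge0 // ler_wiXn2l ?expn_sqr_ge //; try lra.
    by lia.
  rewrite exprM -exprMn lerXn2r ?nnegrE ?mulr_ge0 ?exprn_ge0 //; try lra.
  by rewrite exprVn ler_pdivrMr ?exprn_gt0 //; lra.
have h_ge0 : 0 <= (2^-1 : R) by lra.
split; first by rewrite (le_trans u_le) // exprn_ile1 //; lra.
have [A_le0|A_gt0] := leP A 0.
  by rewrite (le_lt_trans _ ltr01) // mulr_le0_ge0 // mulr_ge0 ?exprn_ge0.
rewrite (le_lt_trans (ler_wpM2l (ltW A_gt0) u_le)) //.
by rewrite exprVn ltr_pdivrMr ?exprn_gt0 // mul1r.
Qed.

Lemma expr_small (R : realType) (y A : R) : 0 <= y < 1 ->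
  exists N, forall m, (N <= m)%N -> A * y ^+ m <= 2^-1.
Proof.
move=> /andP[y0 y1].
have : (fun m => A * y ^+ m) @ \oo --> (A * 0 : R).
  by apply: cvgMr; apply: cvg_expr; rewrite ger0_norm.
rewrite mulr0 => /cvgrPdist_le/(_ 2^-1)[]; first by lra.
move=> N _ HN; exists N => m /HN /=; rewrite sub0r normrN.
exact: le_trans (ler_norm _).
Qed.

Section Mahler.
Variables (R : realType) (al : R) (tau : nat -> R) (C : R).
Hypothesis al01 : 0 < al < 1.
Hypothesis tauS : forall k, tau k = (1 - al ^+ (2 ^ k)) * tau k.+1.
Hypothesis tau_le : forall k, `|tau k - 1| <= C * al ^+ (2 ^ k).

Let x k := al ^+ (2 ^ k).

(** If the form were zero for all large [k], [relation_trivial] would make every coefficient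
    vanish. *)
Lemma auxiliary_neq0 (h : nat -> nat -> int) n :
  (exists i j, [/\ (i < n)%N, (j < n)%N & h i j != 0]) ->
  forall k0, exists2 k, (k0 <= k)%N &
    \sum_(j < n) (\sum_(i < n) (h i j)%:~R * x k ^+ i) * tau k ^+ j != 0.
Proof.
move=> [i0 [j0 [lt_i0 lt_j0 h_neq0]]] k0; have /andP[al0 al1] := al01.
apply: contrapT => noF.
pose p j : {poly R} := \poly_(i < n) (h i j)%:~R.
suff pj0 : p j0 = 0.
  move/(congr1 (fun g : {poly R} => g`_i0))/eqP: pj0.
  by rewrite coef_poly lt_i0 coef0 intr_eq0 (negbTE h_neq0).
apply: (@relation_trivial R x tau _ _ _ tauS n p) => //.
- by move=> k l /(ieexprIn al0 (negbT (lt_eqF al1)))/expnI; apply.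
- by move=> k; rewrite /x expnS mulnC exprM.
- by move=> k; rewrite lt_eqF // exprn_ilt1 ?ltW // -lt0n expn_gt0.
(* [tau] tends to 1, so it is not eventually zero: the error is at most 1/2 at a large index. *)
- case=> l tau0; have [|N HN] := @expr_small R al C; first by rewrite ltW.
  pose m := maxn l N.
  have : C * x m <= 2^-1.
    by rewrite HN // (leq_trans (leq_maxr l N)) // ltnW // ltn_expl.
  have := tau_le m; rewrite tau0 ?leq_maxl // sub0r normrN1 /x; lra.
- exists k0 => k k_ge; apply: contrapT => /eqP F_neq0; apply: noF; exists k => //.
  apply: contra F_neq0 => /eqP F0; apply/eqP; rewrite -[RHS]F0.
  by apply: eq_bigr => j _; rewrite horner_poly.
Qed.

(** The choices are made in the order [e], [N], [h], [k]; constants that depend on the first three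
    are absorbed by the decay in [k]. *)
Theorem mahler_value_neq (p r : {poly int}) :
  algebraicOver (ratr : rat -> R) al -> (map_poly intr r).[al] != 0 ->
  (map_poly intr p).[al] <> tau 0 * (map_poly intr r).[al].
Proof.
move=> alg_al; set y := (map_poly intr p).[al]; set z := (map_poly intr r).[al].
move=> z_neq0 eq_yz; have /andP[al0 al1] := al01.
have al_le1 : `|al| <= 1 by rewrite ger0_norm ltW.
have [d [v [a [B [[a_gt0 le_aB v_free v0 v_le1] rep_al]]]]] :=
  algebraic_matrix_rep al_le1 alg_al.
have [D1 [c1 rep_y0]] := matrix_rep_poly a_gt0 le_aB rep_al p.
have [D2 [c2 rep_z0]] := matrix_rep_poly a_gt0 le_aB rep_al r.
pose e := maxn D1 D2; pose c0 := 1 + `|c1| + `|c2|.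
have c0_ge1 : 1 <= c0 by rewrite /c0 -addrA lerDl addr_ge0.
have rep_y : matrix_rep v a B y e c0.
  apply: (matrix_rep_le a_gt0 le_aB rep_y0); first exact: leq_maxl.
  by rewrite /c0; have := ler_norm c1; have := normr_ge0 c2; lia.
have rep_z : matrix_rep v a B z e c0.
  apply: (matrix_rep_le a_gt0 le_aB rep_z0); first exact: leq_maxr.
  by rewrite /c0; have := ler_norm c2; have := normr_ge0 c1; lia.
(* Per unit of [2 ^ k * n], the Liouville bound costs a factor [B ^+ (E * d.+1)] and the order of
   vanishing gains [al ^+ N]; [N] makes their product at most 1/2. *)
pose E := (2 + 2 * e)%N.
have [|N /(_ N (leqnn N)) HN] := @expr_small R al (B%:~R ^+ (E * d.+1)).
  by rewrite ltW.
(* There are [n * n] unknowns for [n * N] conditions. *)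
pose n := N.+1; pose M := (n * N)%N.
have lt_M : (M < n * n)%N by rewrite /M /n; nia.
have [h [h_neq0 hM]] := auxiliary_poly (thue_morse_prod M) lt_M.
have [C' small] := auxiliary_small al01 tauS tau_le (ltnW (ltn_expl M (ltnSn 1))) hM.
have [c c_ge0 rep_form] := matrix_rep_form a_gt0 le_aB rep_al h n c0_ge1 rep_y rep_z.
set q := (d.+1%:R + d.+1%:R * d.+1%:R : int) in rep_form.
(* The part independent of [k] in the product of the upper bound and the Liouville factor. *)
pose A := `|C'| * `|z| ^+ n * (d.+1%:R * (d`!%:R * c%:~R ^+ d)).
have q_ge0 : 0 <= q by rewrite addr_ge0 // mulr_ge0.
have Q_ge0 : 0 <= (q%:~R ^+ d : R) by rewrite exprn_ge0 // ler0z.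
have [k0 decay] := superexponential_decay A Q_ge0.
have [k /decay[u_le1 Au_lt1] F_neq0] := auxiliary_neq0 h_neq0 k0.
set F := \sum_(j < n) _ in F_neq0.
pose P := \prod_(i < k) (1 - al ^+ (2 ^ i)).
have P_neq0 : P != 0.
  apply/prodf_neq0 => i _; rewrite subr_eq0 eq_sym lt_eqF //.
  by rewrite exprn_ilt1 ?ltW // -lt0n expn_gt0.
have P_le1 : 0 <= P <= 1 by exact: (prod_x_ge0 al01 k 0).
have tau0 : tau 0 = P * tau k by rewrite (tau_prod tauS k 0).
have {}rep_form := rep_form k; rewrite -/P in rep_form.
set Z := \sum_(j < n) _ in rep_form.
(* By [eq_yz] and [tau0], [y] equals [z * P * tau k]. *)
have ZE : Z = (z * P) ^+ n * F.
  rewrite /Z /F mulr_sumr; apply: eq_bigr => j _.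
  rewrite mulr_suml mulr_sumr; apply: eq_bigr => i _.
  rewrite exprM -/(x k) eq_yz tau0.
  have -> : (z * P) ^+ n = (z * P) ^+ (n - j) * (z * P) ^+ j.
    by rewrite -exprD subnK // ltnW.
  rewrite (_ : P * tau k * z = z * P * tau k); last by ring.
  by rewrite [(z * P * tau k) ^+ j]exprMn; ring.
have Z_neq0 : Z != 0 by rewrite ZE mulf_neq0 // expf_neq0 // mulf_neq0.
have := matrix_rep_lower_bound a_gt0 v_free v0 v_le1 rep_form Z_neq0.
rewrite leNgt => /negP; apply; apply: le_lt_trans Au_lt1.
have B_gt0 : 0 < B by apply: lt_le_trans le_aB.
have B_ge0 : 0 <= (B%:~R : R) by rewrite ler0z ltW.
have Z_le : `|Z| <= `|C'| * `|z| ^+ n * al ^+ (2 ^ k * M).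
  rewrite ZE normrM normrX normrM exprMn [`|C'| * _]mulrC -!mulrA.
  rewrite ler_wpM2l ?exprn_ge0 // -[leRHS]mul1r.
  apply: ler_pM => //; rewrite ?exprn_ge0 //.
    by case/andP: P_le1 => P0 P1; rewrite exprn_ile1 ?ger0_norm.
  rewrite (le_trans (small k)) // exprM ler_wpM2r ?ler_norm //.
  by rewrite !exprn_ge0 // ltW.
set u := q%:~R ^+ d ^+ k * 2^-1 ^+ (2 ^ k) in u_le1 *.
have u_ge0 : 0 <= u by rewrite mulr_ge0 // exprn_ge0 // ?invr_ge0.
have A_ge0 : 0 <= A by rewrite !mulr_ge0 ?exprn_ge0 ?ler0z.
apply: (@le_trans _ _ (A * u ^+ n)); last first.
  by rewrite ler_wpM2l // exprS ler_piMr // exprn_ile1.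
pose w := (2 ^ k * n)%N.
pose K : R := d.+1%:R * (d`!%:R * c%:~R ^+ d) * (q%:~R ^+ d ^+ k) ^+ n.
have K_ge0 : 0 <= K by rewrite !mulr_ge0 ?exprn_ge0 ?ler0z.
(* Replacing the leading [a] by [B] adds one more copy to the [d] copies of the power of [B], whence
   [d.+1]. *)
have int_le : (a ^+ (n * (E * 2 ^ k)) * (d.+1%:R * (d`!%:R
      * (c * q ^+ k ^+ n * B ^+ (n * (E * 2 ^ k))) ^+ d)))%:~R
    <= K * (B%:~R ^+ (E * d.+1)) ^+ w.
  have -> : K * (B%:~R ^+ (E * d.+1)) ^+ w = (B ^+ (n * (E * 2 ^ k))
    * (d.+1%:R * (d`!%:R
      * (c * q ^+ k ^+ n * B ^+ (n * (E * 2 ^ k))) ^+ d)))%:~R.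
    have Bw : (B%:~R ^+ (E * d.+1)) ^+ w = B%:~R ^+ (n * (E * 2 ^ k))
        * B%:~R ^+ (n * (E * 2 ^ k)) ^+ d :> R.
      rewrite -!exprM -exprD -mulnS /w; congr (_ ^+ _).
      by rewrite mulnAC [(n * _)%N]mulnC mulnA.
    have qw : (q%:~R ^+ d ^+ k) ^+ n = q%:~R ^+ k ^+ n ^+ d :> R.
      by rewrite -!exprM; congr (_ ^+ _); rewrite mulnC mulnA.
    rewrite !(rmorphM, rmorphXn, rmorph_nat) /= Bw /K qw !exprMn.
    by ring.
  rewrite ler_int ler_wpM2r //.
    by rewrite !mulr_ge0 // exprn_ge0 // !mulr_ge0 ?exprn_ge0 // ltW.
  by rewrite lerXn2r // nnegrE ltW.
apply: le_trans (ler_pM (normr_ge0 _) _ Z_le int_le) _.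
  by rewrite ler0z !mulr_ge0 ?exprn_ge0 // ?mulr_ge0 ?exprn_ge0 // ltW.
have -> : al ^+ (2 ^ k * M) = (al ^+ N) ^+ w.
  by rewrite -exprM /w /M [(N * _)%N]mulnC mulnA.
rewrite [leLHS](_ : _ = A * (q%:~R ^+ d ^+ k) ^+ n
    * (B%:~R ^+ (E * d.+1) * al ^+ N) ^+ w); last first.
  by rewrite /A /K exprMn; ring.
have -> : A * u ^+ n = A * (q%:~R ^+ d ^+ k) ^+ n * 2^-1 ^+ w.
  by rewrite /u /w exprMn [2^-1 ^+ (_ * _)]exprM mulrA.
apply: ler_wpM2l.
  by rewrite mulr_ge0 // exprn_ge0 // exprn_ge0.
by rewrite lerXn2r // nnegrE ?invr_ge0 // mulr_ge0 ?exprn_ge0 // ltW.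
Qed.
End Mahler.

(** * The Thue-Morse power series *)

Lemma thue_morse_01 n : thue_morse n = 0 \/ thue_morse n = 1.
Proof.
have [m] := ubnP n; elim: m n => // m IHm n; rewrite ltnS => le_nm.
case: (posnP n) => [->|n_gt0]; first by left.
have {IHm}IH : thue_morse n./2 = 0 \/ thue_morse n./2 = 1.
  by apply: IHm; apply: leq_trans le_nm; rewrite ltn_half_double -addnn; lia.
rewrite -(odd_double_half n); case: (odd n).
  by rewrite add1n thue_morse_odd; case: IH => ->; [right | left].
by rewrite add0n thue_morse_even.
Qed.

Section SignSeries.
Variable R : realType.

Definition thue_morse_sign n : R := 1 - 2 * (thue_morse n)%:~R.

Definition thue_morse_value (y : R) : R := limn (pseries thue_morse_sign y).

Lemma norm_thue_morse_sign n : `|thue_morse_sign n| = 1.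
Proof.
rewrite /thue_morse_sign; case: (thue_morse_01 n) => ->.
  by rewrite mulr0 subr0 normr1.
by rewrite mulr1 (_ : 1 - 2 = -1) ?normrN1 //; ring.
Qed.

Lemma is_cvg_thue_morse_value y : 0 <= y < 1 ->
  cvgn (pseries thue_morse_sign y).
Proof.
move=> /andP[y0 y1]; apply: normed_cvg.
have -> : [normed pseries thue_morse_sign y] = series (geometric 1 y).
  apply/funext => n; apply: eq_bigr => i _.
  by rewrite /= normrM norm_thue_morse_sign normrX ger0_norm.
by apply: is_cvg_geometric_series; rewrite ger0_norm.
Qed.

(** Terms of index 2k and 2k+1 have opposite signs, so each pair has a factor [1 - y]; partial sums
    of even length suffice for the limit. *)
Lemma thue_morse_value_sqr y : 0 <= y < 1 ->
  thue_morse_value y = (1 - y) * thue_morse_value (y ^+ 2).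
Proof.
move=> y01; have /andP[y0 y1] := y01.
have ysqr01 : 0 <= y ^+ 2 < 1 by rewrite exprn_ge0 //= exprn_ilt1.
have pseries2 n : pseries thue_morse_sign y (2 * n)%N
    = (1 - y) * pseries thue_morse_sign (y ^+ 2) n.
  rewrite /pseries /series /=; elim: n => [|n IHn].
    by rewrite muln0 !big_geq // mulr0.
  rewrite mulnS addnC addn2 !big_nat_recr //= IHn mul2n.
  rewrite /thue_morse_sign thue_morse_even thue_morse_odd rmorphB rmorph1.
  rewrite [RHS]mulrDr -[LHS]addrA; congr (_ + _).
  by rewrite exprS -mul2n exprM; ring.
have cvg1 : (fun n => pseries thue_morse_sign y (2 * n)%N) @ \oo
    --> thue_morse_value y.
  apply: (@cvg_comp _ _ _ (muln 2) (pseries thue_morse_sign y)).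
    exact: cvg_mulnl.
  exact: is_cvg_thue_morse_value.
have cvg2 : (fun n => pseries thue_morse_sign y (2 * n)%N) @ \oo
    --> (1 - y) * thue_morse_value (y ^+ 2).
  under eq_fun do rewrite pseries2.
  by apply: cvgMr; exact: is_cvg_thue_morse_value.
exact: (cvg_unique _ cvg1 cvg2).
Qed.

Lemma thue_morse_value_near1 y : 0 <= y < 1 ->
  `|thue_morse_value y - 1| <= y / (1 - y).
Proof.
move=> y01; have /andP[y0 y1] := y01.
have y1_gt0 : 0 < 1 - y by rewrite subr_gt0.
(* The geometric bound on the terms after the first, multiplied by [1 - y] so that the induction is
   linear. *)
have part n : (1 - y) * `|pseries thue_morse_sign y n.+1 - 1| <= y - y ^+ n.+1.
  rewrite /pseries /series /=; elim: n => [|n IHn].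
    rewrite big_nat1 expr0 mulr1 /thue_morse_sign thue_morse0 mulr0 subr0 subrr.
    by rewrite normr0 mulr0 expr1 subrr.
  rewrite big_nat_recr //= addrAC.
  set s := \sum_(_ <= _ < _) _ in IHn *.
  have : `|s - 1 + thue_morse_sign n.+1 * y ^+ n.+1| <= `|s - 1| + y ^+ n.+1.
    rewrite (le_trans (ler_normD _ _)) // lerD2l normrM norm_thue_morse_sign.
    by rewrite mul1r ger0_norm // exprn_ge0.
  move=> /(ler_wpM2l (ltW y1_gt0)); move: IHn; rewrite [y ^+ n.+2]exprS mulrDr.
  by rewrite mulrBl mul1r; lra.
have cvgT := is_cvg_thue_morse_value y01.
rewrite ler_pdivlMr // mulrC.
have cvgN : (fun n => (1 - y) * `|pseries thue_morse_sign y n.+1 - 1|) @ \oo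
    --> (1 - y) * `|thue_morse_value y - 1|.
  apply: cvgMr; apply: cvg_norm; apply: cvgB; last exact: cvg_cst.
  by rewrite (@cvg_shiftS R (pseries thue_morse_sign y)).
rewrite -(cvg_lim _ cvgN) //; apply: limr_le; first exact: cvgP cvgN.
near=> n; rewrite (le_trans (part n)) // gerBl exprn_ge0 //.
Unshelve. all: by end_near.
Qed.

End SignSeries.

(** Mahler's method with [tau k] the value of T at [al ^+ (2 ^ k)]; the constant [(1 - al)^-1] is
    uniform because these points are at most [al]. *)
Lemma thue_morse_value_not_quotient (R : realType) (al : R) (p r : {poly int}) :
  0 < al < 1 -> algebraicOver (ratr : rat -> R) al ->
  (map_poly intr r).[al] != 0 ->
  (map_poly intr p).[al] <> thue_morse_value al * (map_poly intr r).[al].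
Proof.
move=> al01 alg_al; have /andP[al0 al1] := al01.
have x01 k : 0 <= al ^+ (2 ^ k) < 1.
  by rewrite exprn_ge0 ?ltW //= exprn_ilt1 ?ltW // -lt0n expn_gt0.
have := @mahler_value_neq R al (fun k => thue_morse_value (al ^+ (2 ^ k)))
  (1 - al)^-1 al01 _ _ p r alg_al; rewrite expn0 expr1; apply.
- by move=> k; rewrite [LHS]thue_morse_value_sqr // -exprM -expnSr.
move=> k; apply: le_trans (thue_morse_value_near1 (x01 k)) _.
have /andP[x0 x1] := x01 k.
have le_x : al ^+ (2 ^ k) <= al by rewrite ler_iXnr ?ltW // expn_gt0.
by rewrite mulrC ler_wpM2r // lef_pV2 ?posrE; lra.
Qed.

(** * The equation for lambda and its transcendence *)

Lemma thue_morse1 : thue_morse 1 = 1. Proof. by []. Qed.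
Lemma thue_morse2 : thue_morse 2 = 1. Proof. by []. Qed.
Lemma thue_morse3 : thue_morse 3 = 0. Proof. by []. Qed.

Lemma m_seq0 (b t : int) : m_seq b t 0 = t.
Proof. by rewrite /m_seq thue_morse0 thue_morse1; lia. Qed.

Lemma m_seq1 (b t : int) : m_seq b t 1 = b - t + 1.
Proof. by rewrite /m_seq thue_morse1 thue_morse2; lia. Qed.

Lemma m_seq2 (b t : int) : m_seq b t 2 = b - t.
Proof. by rewrite /m_seq thue_morse2 thue_morse3; lia. Qed.

Lemma defines_lambda_eq (R : realType) (b t : int) (lam : R) :
  defines_lambda b t lam ->
  thue_morse_value lam^-1 * ((1 - lam^-1) * (1 - (2 * t - b - 1)%:~R * lam^-1))
  = (b + 1)%:~R * lam^-1 - 1.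
Proof.
move=> [lam1 _ cvg_m]; set al := lam^-1.
have lam0 : 0 < lam by apply: lt_trans lam1.
have al0 : 0 < al by rewrite invr_gt0.
have al1 : al < 1 by rewrite invf_lt1.
set c : R := (2 * t - b - 1)%:~R.
pose G n : R := series (geometric 1 al) n.
pose S n : R := pseries (@thue_morse_sign R) al n.
(* Twice [thue_morse n] is 1 minus the sign. The shifted sums [G N.+1 - S N.+1] have the extra term
   of index 0, which is zero as the sequence starts with 0. *)
have part N : 2 * series (fun n => (m_seq b t n)%:~R * lam ^- n.+1) N
    = (G N.+1 - S N.+1) - c * al * (G N - S N) + 2 * (t%:~R - 1) * al * G N.
  elim: N => [|N IHN].
    rewrite /G /S /pseries /series /= !big_nat1 !big_geq //=.
    by rewrite /thue_morse_sign thue_morse0 !expr0; ring.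
  have -> : series (fun n => (m_seq b t n)%:~R * lam ^- n.+1) N.+1
    = series (fun n => (m_seq b t n)%:~R * lam ^- n.+1) N
      + (m_seq b t N)%:~R * al ^+ N.+1.
    by rewrite /series /= big_nat_recr //= exprVn.
  have GS n : G n.+1 = G n + al ^+ n.
    by rewrite /G /series /= big_nat_recr //= mul1r.
  have SS n : S n.+1 = S n + thue_morse_sign R n * al ^+ n.
    by rewrite /S /pseries /series /= big_nat_recr.
  rewrite mulrDr IHN (GS N.+1) (GS N) (SS N.+1) (SS N) /thue_morse_sign.
  rewrite /m_seq /c !(rmorphD, rmorphB, rmorphN, rmorphM) /= !exprS.
  by ring.
have cvgG : G @ \oo --> (1 - al)^-1.
  have := @cvg_geometric_series R 1 al; rewrite mul1r; apply.
  by rewrite ger0_norm // ltW.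
have cvgS : S @ \oo --> thue_morse_value al.
  by apply: is_cvg_thue_morse_value; rewrite ltW.
have cvgGS : (fun N => G N.+1) @ \oo --> (1 - al)^-1 by rewrite cvg_shiftS.
have cvgSS : (fun N => S N.+1) @ \oo --> thue_morse_value al by rewrite cvg_shiftS.
have cvgR : (fun N => (G N.+1 - S N.+1) - c * al * (G N - S N)
      + 2 * (t%:~R - 1) * al * G N) @ \oo -->
    ((1 - al)^-1 - thue_morse_value al) - c * al * ((1 - al)^-1 - thue_morse_value al)
      + 2 * (t%:~R - 1) * al * (1 - al)^-1.
  apply: cvgD; last exact: cvgMr.
  by apply: cvgB; [apply: cvgB | apply: cvgMr; apply: cvgB].
have cvgL : (fun N => (G N.+1 - S N.+1) - c * al * (G N - S N)
      + 2 * (t%:~R - 1) * al * G N) @ \oo --> (2 * 1 : R).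
  by under eq_fun do rewrite -part; apply: cvgMr.
have := cvg_lim (@Rhausdorff R) cvgR; rewrite (cvg_lim (@Rhausdorff R) cvgL).
(* Multiplying by [1 - al] clears the limit of the geometric series. *)
move=> /(_ _)/esym/(congr1 (fun z => z * (1 - al))).
have al1_neq0 : 1 - al != 0 by rewrite subr_eq0 eq_sym lt_eqF.
set T := thue_morse_value al; set g := (1 - al)^-1.
have gE : g * (1 - al) = 1 by rewrite mulVf.
rewrite [LHS](_ : _ = (g * (1 - al)) * (1 - c * al + 2 * (t%:~R - 1) * al)
  - T * ((1 - al) * (1 - c * al))); last by ring.
rewrite gE /c !(rmorphD, rmorphB, rmorphN, rmorphM) /=; lra.
Qed.

Section Coefficients.
Variables (b t : int).
Hypotheses (hb : 1 <= b) (ht0 : 0 <= t) (htb : t <= b) (hbt : b + 1 <= 2 * t).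

(** The only values are [t - 1], [t], [b - t] and [b - t + 1], and the hypotheses force [1 <= t]. *)
Lemma m_seq_bounds n : 0 <= m_seq b t n <= b.
Proof.
rewrite /m_seq.
by case: (thue_morse_01 n) => ->; case: (thue_morse_01 n.+1) => ->; lia.
Qed.

Lemma defines_lambda_transcendental (R : realType) (lam : R) :
  defines_lambda b t lam -> transcendental lam.
Proof.
move=> def_lam alg_lam; have [lam1 _ _] := def_lam.
have lam0 : 0 < lam by apply: lt_trans lam1.
have := defines_lambda_eq def_lam; set al := lam^-1; set c := 2 * t - b - 1.
have al0 : 0 < al by rewrite invr_gt0.
have al1 : al < 1 by rewrite invf_lt1.
pose p : {poly int} := (b + 1)%:P * 'X - 1.
pose r (k : int) : {poly int} := (1 - 'X) * (1 - k%:P * 'X).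
have pE : (map_poly intr p).[al] = (b + 1)%:~R * al - 1.
  by rewrite rmorphB rmorphM rmorph1 /= map_polyC map_polyX !hornerE.
have rE k : (map_poly intr (r k)).[al] = (1 - al) * (1 - k%:~R * al).
  rewrite rmorphM !rmorphB rmorphM rmorph1 /= map_polyC map_polyX.
  by rewrite !hornerE.
rewrite -pE -rE => /esym; apply: thue_morse_value_not_quotient.
- by rewrite al0.
- exact: algebraic_inv.
rewrite rE mulf_neq0 //; first by rewrite subr_eq0 eq_sym lt_eqF.
(* If [c * al = 1], the equation for lambda gives [(b + 1) * al = 1] as well, hence [c = b + 1] and
   [t = b + 1], which exceeds [b]. *)
apply/eqP => c_al; have := defines_lambda_eq def_lam; rewrite -/al -/c c_al.
rewrite !mulr0 => /esym b_al.
have : ((b + 1)%:~R - c%:~R) * al = 0 by lra.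
move/eqP; rewrite mulf_eq0 (gt_eqF al0) orbF -intrB intr_eq0 /c => /eqP; lia.
Qed.

End Coefficients.

(** * Existence and uniqueness of lambda *)

(** Convexity of the power function: slopes increase from [x, y] to [y, r], stated without
    division. *)
Lemma expr_slope (R : realDomainType) (x y r : R) m : 0 <= x -> x <= y -> y <= r ->
  (r - y) * (y ^+ m - x ^+ m) <= (y - x) * (r ^+ m - y ^+ m).
Proof.
move=> x0 xy yr; have y0 := le_trans x0 xy; have r0 := le_trans y0 yr.
elim: m => [|m IHm]; first by rewrite !expr0 !subrr !mulr0.
have xym : x ^+ m <= y ^+ m by rewrite lerXn2r.
have yrm : y ^+ m <= r ^+ m by rewrite lerXn2r.
have h1 : y * ((r - y) * (y ^+ m - x ^+ m)) <= r * ((y - x) * (r ^+ m - y ^+ m)).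
  apply: ler_pM => //; by rewrite mulr_ge0 ?subr_ge0.
have h2 : (r - y) * (y - x) * x ^+ m <= (r - y) * (y - x) * y ^+ m.
  by rewrite ler_wpM2l // mulr_ge0 ?subr_ge0.
rewrite !exprS; nra.
Qed.

Section PositiveSeries.
Variables (R : realType) (c : nat -> R) (K : R).
Hypothesis c_ge0 : forall n, 0 <= c n.
Hypothesis c_le : forall n, c n <= K.

Let f y n : R := c n * y ^+ n.+1.
Let F y := limn (series (f y)).

Lemma is_cvg_positive_series y : 0 <= y < 1 -> cvgn (series (f y)).
Proof.
move=> /andP[y0 y1].
apply: (@series_le_cvg R (f y) (geometric (K * y) y)).
- by move=> n; rewrite mulr_ge0 ?exprn_ge0.
- by move=> n; rewrite !mulr_ge0 ?exprn_ge0 // (le_trans (c_ge0 0)).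
- by move=> n /=; rewrite -mulrA -exprS ler_wpM2r // exprn_ge0.
by apply: is_cvg_geometric_series; rewrite ger0_norm.
Qed.

(** Convexity term by term, with the nonnegative value at [y] dropped on the right; it yields the
    Lipschitz bound behind continuity. *)
Lemma positive_series_slope x y r : 0 <= x -> x <= y -> y <= r -> r < 1 ->
  (r - y) * (F y - F x) <= (y - x) * F r.
Proof.
move=> x0 xy yr r1; have y0 := le_trans x0 xy; have r0 := le_trans y0 yr.
have cx : cvgn (series (f x)).
  by apply: is_cvg_positive_series; rewrite x0 (le_lt_trans xy) // (le_lt_trans yr).
have cy : cvgn (series (f y)).
  by apply: is_cvg_positive_series; rewrite y0 (le_lt_trans yr).
have cr : cvgn (series (f r)) by apply: is_cvg_positive_series; rewrite r0.
have cL : (fun N => (r - y) * (series (f y) N - series (f x) N)) @ \oo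
    --> (r - y) * (F y - F x) by apply: cvgMr; apply: cvgB.
have cR : (fun N => (y - x) * series (f r) N) @ \oo --> (y - x) * F r.
  exact: cvgMr.
apply: ler_cvg_to cL cR _; near=> N.
rewrite -sumrB !mulr_sumr; apply: ler_sum => n _; rewrite /f -mulrBr.
rewrite mulrCA [leRHS]mulrCA ler_wpM2l //.
apply: le_trans (expr_slope n.+1 x0 xy yr) _.
by rewrite ler_wpM2l ?subr_ge0 // gerBl exprn_ge0.
Unshelve. all: by end_near.
Qed.

Lemma positive_series_le x y : 0 <= x -> x <= y -> y < 1 -> F x <= F y.
Proof.
move=> x0 xy y1; apply: lim_series_le.
- by apply: is_cvg_positive_series; rewrite x0 (le_lt_trans xy).
- by apply: is_cvg_positive_series; rewrite (le_trans x0).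
by move=> n; rewrite ler_wpM2l // lerXn2r // nnegrE (le_trans x0).
Qed.

Lemma continuous_positive_series x : 0 < x < 1 -> {for x, continuous F}.
Proof.
(* [F] is Lipschitz on [0, y1] with constant [F r / (r - y1)], for midpoints chosen so that x < y1 <
   r < 1. *)
move=> /andP[x0 x1]; pose y1 := (x + 1) / 2; pose r := (y1 + 1) / 2.
have y1r : y1 < r by rewrite /r /y1; lra.
have r1 : r < 1 by rewrite /r /y1; lra.
have xy1 : x < y1 by rewrite /y1; lra.
pose L := F r / (r - y1).
have Fr_ge0 : 0 <= F r.
  apply: limr_ge; first by apply: is_cvg_positive_series; rewrite /r /y1; lra.
  near=> n; apply: sumr_ge0 => i _; rewrite mulr_ge0 // exprn_ge0 //.
  by rewrite /r /y1; lra.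
have lip u w : 0 <= u -> u <= w -> w <= y1 -> `|F w - F u| <= (w - u) * L.
  move=> u0 uw wy; have := @positive_series_slope u w r u0 uw.
  have w1 : w < 1 by lra.
  have Fuw : F u <= F w by exact: positive_series_le.
  rewrite ger0_norm ?subr_ge0 // => /(_ (ltW (le_lt_trans wy y1r)) r1) slope.
  rewrite mulrA ler_pdivlMr ?subr_gt0 // mulrC (le_trans _ slope) //.
  by rewrite ler_wpM2r ?subr_ge0 // lerD2l lerN2.
have L_ge0 : 0 <= L by rewrite divr_ge0 // subr_ge0 ltW.
apply/cvgrPdist_le => e e0; near=> w.
have w0 : 0 <= w by apply: ltW; near: w; exact: lt_nbhsr.
have wy1 : w <= y1 by apply: ltW; near: w; exact: lt_nbhsl.
have dist : `|x - w| <= e / (L + 1).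
  near: w; have e' : 0 < e / (L + 1) by rewrite divr_gt0 //; lra.
  by move/cvgrPdist_le: (@cvg_id _ (nbhs x)) => /(_ _ e').
have : `|F x - F w| <= `|x - w| * L.
  have [xw|wx] := leP x w.
    by rewrite distrC [`|x - w|]distrC [`|w - x|]ger0_norm ?subr_ge0 // lip // ltW.
  have wx' := ltW wx.
  by rewrite [`|x - w|]ger0_norm ?subr_ge0 // lip // ltW.
move=> /le_trans; apply; apply: (@le_trans _ _ (e / (L + 1) * L)).
  by rewrite ler_wpM2r.
rewrite mulrAC ler_pdivrMr; last by lra.
by rewrite ler_wpM2l ?ltW //; lra.
Unshelve. all: by end_near.
Qed.

Lemma positive_series_root y1 y2 : 0 < y1 -> y1 < y2 -> y2 < 1 ->
  F y1 < 1 -> 1 < F y2 -> exists y, y1 < y < y2 /\ series (f y) @ \oo --> (1 : R).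
Proof.
move=> y1_gt0 y12 y2_lt1 F1 F2.
have [||y] := @IVT R F y1 y2 1 (ltW y12).
- apply: continuous_in_subspaceT => z; rewrite inE /= in_itv /= => /andP[z1 z2].
  by apply: continuous_positive_series; rewrite (lt_le_trans y1_gt0) //=;
    apply: le_lt_trans y2_lt1.
- by rewrite ge_min le_max (ltW F1) (ltW F2) orbT.
rewrite in_itv /= => /andP[yy1 yy2] Fy; exists y; split.
  rewrite !lt_neqAle yy1 yy2 !andbT; apply/andP; split.
    by apply: contraTneq F1 => ->; rewrite Fy ltxx.
  by apply: contraTneq F2 => <-; rewrite Fy ltxx.
rewrite -Fy; apply: is_cvg_positive_series.
by rewrite (le_trans (ltW y1_gt0)) //= (le_lt_trans yy2).
Qed.

End PositiveSeries.

Section Existence.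
Variables (R : realType) (b t : int).
Hypotheses (hb : 1 <= b) (ht0 : 0 <= t) (htb : t <= b) (hbt : b + 1 <= 2 * t).

Let c n : R := (m_seq b t n)%:~R.
Let c_ge0 n : 0 <= c n.
Proof. by rewrite /c ler0z; case/andP: (m_seq_bounds hb ht0 htb hbt n). Qed.
Let c_le n : c n <= b%:~R.
Proof. by rewrite /c ler_int; case/andP: (m_seq_bounds hb ht0 htb hbt n). Qed.

Lemma defines_lambda_exists : exists lam : R, defines_lambda b t lam.
Proof.
have b1 : 1 <= (b%:~R : R) by rewrite ler1z.
have t1 : 1 <= (t%:~R : R) by rewrite ler1z; lia.
have bt0 : 0 <= (b%:~R - t%:~R : R) by rewrite -intrB ler0z; lia.
(* [y1] corresponds to the upper limit [b + 1] for lambda; 7/10 is a point below 1 where the first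
   two terms already exceed 1. *)
pose y1 : R := (b%:~R + 1)^-1; pose y2 : R := 7 / 10.
have y1_gt0 : 0 < y1 by rewrite invr_gt0; lra.
have by1 : b%:~R * y1 = 1 - y1.
  have : y1 * (b%:~R + 1) = 1 by rewrite mulVf // gt_eqF //; lra.
  by lra.
have y1_le : y1 <= 2^-1 by nra.
have [|||| y [/andP[yy1 yy2] cvg_y]] :=
  @positive_series_root R c b%:~R c_ge0 c_le y1 y2 y1_gt0.
- by rewrite /y2; lra.
- by rewrite /y2; lra.
(* With all coefficients equal to [b] the series at [y1] would sum to 1. The third coefficient
   [b - t] is at most [b - 1], and the margin [y1 ^+ 3] it leaves keeps the inequality strict in the
   limit. *)
- have part N : series (fun n => c n * y1 ^+ n.+1) N.+3 <= 1 - y1 ^+ 3 - y1 ^+ N.+3.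
    elim: N => [|N IHN].
      rewrite /series /= !big_nat_recr //= big_geq // add0r /c.
      rewrite m_seq0 m_seq1 m_seq2 !(rmorphD, rmorphB, rmorphN, rmorph1) /=.
      have y1X n : 0 <= y1 ^+ n by rewrite exprn_ge0 // ltW.
      have h1 : 0 <= (b%:~R - t%:~R) * y1 ^+ 1 by rewrite mulr_ge0.
      have h2 : 0 <= (t%:~R - 1) * y1 ^+ 2 by rewrite mulr_ge0 // subr_ge0.
      have h3 : 0 <= (t%:~R - 1) * y1 ^+ 3 by rewrite mulr_ge0 // subr_ge0.
      have e2 : b%:~R * y1 ^+ 2 = y1 - y1 ^+ 2.
        by rewrite expr2 mulrA by1; ring.
      have e3 : b%:~R * y1 ^+ 3 = y1 ^+ 2 - y1 ^+ 3.
        by rewrite exprS mulrA by1; ring.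
      by rewrite expr1 in h1 *; lra.
    rewrite /series /= big_nat_recr //=; rewrite /series /= in IHN.
    have : c N.+3 * y1 ^+ N.+4 <= (1 - y1) * y1 ^+ N.+3.
      rewrite exprS mulrA ler_wpM2r ?exprn_ge0 ?(ltW y1_gt0) // -by1.
      by rewrite ler_wpM2r // ltW.
    by rewrite [y1 ^+ N.+4]exprS; lra.
  apply: (@le_lt_trans _ _ (1 - y1 ^+ 3)); last first.
    by rewrite ltrBlDr ltrDl exprn_gt0.
  apply: limr_le.
    by apply: is_cvg_positive_series c_ge0 c_le _ _; rewrite ltW //=; lra.
  near=> N; have -> : N = (N - 3).+3 by rewrite -addn3 subnK //; near: N; exists 3.
  by rewrite (le_trans (part _)) // gerBl exprn_ge0 // ltW.
(* As [1 <= t] and [1 <= b - t + 1], the first two terms add up to at least 7/10 + 49/100. *)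
- apply: (@lt_le_trans _ _ (119 / 100)); first by lra.
  apply: limr_ge.
    by apply: is_cvg_positive_series c_ge0 c_le _ _; rewrite /y2; lra.
  near=> N; have -> : N = (2 + (N - 2))%N by rewrite subnKC //; near: N; exists 2.
  rewrite /series /= (big_cat_nat (n := 2)) ?leq_addr //=.
  rewrite -[leLHS]addr0; apply: lerD.
    rewrite !big_nat_recr //= big_geq // add0r /c m_seq0 m_seq1.
    rewrite !(rmorphD, rmorphB, rmorphN, rmorph1) /= /y2; lra.
  by apply: sumr_ge0 => n _; rewrite mulr_ge0 // exprn_ge0 // /y2; lra.
exists y^-1.
have y0 : 0 < y by apply: lt_trans yy1.
split.
- by rewrite invf_gt1 //; rewrite /y2 in yy2; lra.
- by rewrite rmorphD rmorph1 /= -[X in _ < X]invrK ltf_pV2 // posrE.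
by under eq_fun do rewrite -exprVn invrK.
Unshelve. all: by end_near.
Qed.

(** The series is strictly monotone in the inverse of lambda: no term decreases, and the first
    coefficient [t] is positive. *)
Lemma defines_lambda_le (lam lam' : R) :
  defines_lambda b t lam -> defines_lambda b t lam' -> lam' <= lam.
Proof.
move=> [lam1 _ cvg1] [lam1' _ cvg2]; rewrite leNgt; apply/negP => lt_lam.
have t0 : 0 < (t%:~R : R) by rewrite ltr0z; lia.
have lam0 : 0 < lam by apply: lt_trans lam1.
have lam0' : 0 < lam' by apply: lt_trans lam1'.
have inv_lt : lam'^-1 < lam^-1 by rewrite ltf_pV2 ?posrE.
(* The gap between the two first terms, which survives in the limit. *)
pose e := t%:~R * (lam^-1 - lam'^-1); have e_gt0 : 0 < e.
  by rewrite mulr_gt0 // subr_gt0.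
suff : 1 + e <= 1 by lra.
have cvg2e : (fun n => series (fun n => c n * lam' ^- n.+1) n + e) @ \oo --> 1 + e.
  by apply: cvgD; [exact: cvg2 | exact: cvg_cst].
apply: ler_cvg_to cvg2e cvg1 _; near=> N.
have -> : N = N.-1.+1 by rewrite prednK //; near: N; exists 1%N.
rewrite /series /= !big_nat_recl //= !expr1 -addrA [_ + e]addrC addrA /c m_seq0.
rewrite /e -mulrDr subrKC lerD2l; apply: ler_sum => n _.
rewrite ler_wpM2l // ?c_ge0 // -!exprVn lerXn2r // ?nnegrE ?invr_ge0 ltW //.
Unshelve. all: by end_near.
Qed.

End Existence.

Theorem theorem4p1 (R : realType) (b t : int)
    (hb : 1 <= b) (ht0 : 0 <= t) (htb : t <= b) (hbt : b + 1 <= 2 * t) :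
  (exists! lam : R, defines_lambda b t lam) /\
  (forall lam : R, defines_lambda b t lam -> transcendental lam).
Proof.
split; last by move=> lam; exact: defines_lambda_transcendental.
have [lam def_lam] := @defines_lambda_exists R b t hb ht0 htb hbt.
exists lam; split => // lam' def_lam'; apply/le_anti/andP.
by split; apply: (@defines_lambda_le R b t).
Qed.
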